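(* Let $r,n$ be positive integers and $\vec\lambda=(\lambda^0,\dots,\lambda^{r-1})\in\mathcal{P}_{r,n}$. Then $$\iota\bigl[s_{\lambda^0}(\mathbf{z}^0)\,s_{\lambda^1}(\mathbf{z}^1)\cdots s_{\lambda^{r-1}}(\mathbf{z}^{r-1})\bigr]=\sum_{T\in\mathrm{SYT}(\vec\lambda)}\ \prod_{i=1}^n q_i^{f_i(T)}\cdot\frac{1}{\prod_{i=1}^n(1-q_1^rq_2^r\cdots q_i^r)},$$ where $$\mathbf{z}^0=(1,\;y_1y_2\cdots y_r,\;y_1\cdots y_{2r},\dots),\quad \mathbf{z}^1=(y_1,\;y_1y_2\cdots y_{r+1},\;y_1y_2\cdots y_{2r+1},\dots),\ \dots,$$ $$\mathbf{z}^{r-1}=(y_1y_2\cdots y_{r-1},\;y_1y_2\cdots y_{2r-1},\dots),$$ i.e. $\mathbf{z}^j$ is the sequence of monomials $y_1y_2\cdots y_{j+mr}$, $m=0,1,2,\dots$.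
   Context: $\mathcal{P}_{r,n}$ is the set of $r$-tuples of partitions $\vec\lambda=(\lambda^0,\dots,\lambda^{r-1})$ with $\sum_i|\lambda^i|=n$. $s_\lambda$ is the Schur function. $\iota:\mathbb{C}[[y_1,y_1y_2,\dots]]\to\mathbb{C}[[q_1,q_1q_2,\dots]]$ is the linear map (extended to infinite linear combinations; not a ring homomorphism) defined on monomials by $\iota(\mathbf{y}^\lambda)=\mathbf{q}^{\lambda'}$ for every partition $\lambda$, where $\mathbf{y}^\lambda=y_1^{\lambda_1}y_2^{\lambda_2}\cdots$, $\mathbf{q}^{\mu}=q_1^{\mu_1}q_2^{\mu_2}\cdots$, and $\lambda'$ is the conjugate partition. The diagram of $\vec\lambda$ is the union of the diagrams (English notation) of $\lambda^0,\dots,\lambda^{r-1}$, the $(i+1)$-th lying strictly south-west of the $i$-th. A standard Young $r$-tableau $T=(T^0,\dots,T^{r-1})$ of shape $\vec\lambda$ is a filling with $1,\dots,n$ (each once), increasing along rows and down columns of each component separately; $\mathrm{SYT}(\vec\lambda)$ is the set of these. $\mathrm{Des}(T)$ is the set of $i\in\{1,\dots,n-1\}$ such that $i+1$ lies strictly below $i$ in this arrangement; $d_i(T)=|\{j\in\mathrm{Des}(T):j\ge i\}|$; $c_i(T)=k$ if $i\in T^k$; $f_i(T)=r\,d_i(T)+c_i(T)$. *)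

(* Defs.v *)
From HB Require Import structures.
From mathcomp Require Import all_boot all_order all_algebra finmap monalg.
From mathcomp Require Import boolp classical_sets cardinality fsbigop reals.
From mathcomp Require Import complex.

Set Implicit Arguments.
Unset Strict Implicit.
Unset Printing Implicit Defensive.

Import GRing.Theory.

Local Open Scope ring_scope.
Local Open Scope classical_set_scope.

(* Formal power series over K in countably many variables: arbitrary families
   of coefficients indexed by the monomials {cmonom nat}. Variables are
   numbered from 0, so the variable of index i is the y_{i+1} (or q_{i+1}) of
   the usual notation. The record keeps the pointwise ring structure of
   function types from being inferred here. *)
Record fps (K : Type) := FPS { fcoef : {cmonom nat} -> K }.

HB.instance Definition _ (K : Type) := gen_eqMixin (fps K).
HB.instance Definition _ (K : Type) := gen_choiceMixin (fps K).

Lemma fpsP (K : Type) (f g : fps K) :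
  (forall m, fcoef f m = fcoef g m) -> f = g.
Proof. by case: f g => [f] [g] /= fg; congr FPS; apply/funext. Qed.

Section FpsZmodule.
Variable K : zmodType.

Definition fps_zero : fps K := FPS (fun=> 0).
Definition fps_opp (f : fps K) := FPS (fun m => - fcoef f m).
Definition fps_add (f g : fps K) := FPS (fun m => fcoef f m + fcoef g m).

Fact fps_addA : associative fps_add.
Proof. by move=> f g h; apply: fpsP => m /=; rewrite addrA. Qed.
Fact fps_addC : commutative fps_add.
Proof. by move=> f g; apply: fpsP => m /=; rewrite addrC. Qed.
Fact fps_add0 : left_id fps_zero fps_add.
Proof. by move=> f; apply: fpsP => m /=; rewrite add0r. Qed.
Fact fps_addN : left_inverse fps_zero fps_opp fps_add.
Proof. by move=> f; apply: fpsP => m /=; rewrite addNr. Qed.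

HB.instance Definition _ :=
  GRing.isZmodule.Build (fps K) fps_addA fps_addC fps_add0 fps_addN.

End FpsZmodule.

Section MonomialFactors.
Implicit Types a b c m : {cmonom nat}.

Definition factors m : seq {cmonom nat} :=
  undup [seq [cmonom (g i : nat) | i : finsupp m]%M
        | g : {ffun finsupp m -> 'I_(mdeg m).+1}].

Lemma factors_uniq m : uniq (factors m). Proof. exact: undup_uniq. Qed.

Lemma cm_le_mdeg m i : (m i <= mdeg m)%N.
Proof.
have [im|im] := boolP (i \in finsupp m); last by rewrite fsfun_dflt.
by rewrite mdegE (big_fsetD1 i) //= leq_addr.
Qed.

Lemma factorsP a b : a \in factors (mmul a b).
Proof.
have ab i : (a i <= mmul a b i)%N by rewrite cmM leq_addr.
rewrite mem_undup; apply/mapP.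
exists [ffun i : finsupp (mmul a b) => inord (a (val i))].
  by rewrite mem_enum.
apply/eqP/cmP => i; rewrite cmE /= fsfun_ffun.
case: insubP => [u _ <-|/fsfun_dflt iab] /=.
  by rewrite ffunE inordK // ltnS (leq_trans (ab _)) ?cm_le_mdeg.
by move: (ab i); rewrite iab leqn0 => /eqP.
Qed.

Lemma factorsMl a b c : a \in factors (mmul (mmul a b) c).
Proof. by rewrite -mulmA factorsP. Qed.

Lemma factorsMr a b : b \in factors (mmul a b).
Proof. by rewrite mulmC factorsP. Qed.

End MonomialFactors.

Section FpsRing.
Variable K : comNzRingType.
Implicit Types f g h : fps K.

Definition fps_one : fps K := FPS (fun m => (m == mone)%:R).

Definition fps_mul f g : fps K :=
  FPS (fun m => \sum_(p \in [set p : {cmonom nat} * {cmonom nat}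
                            | mmul p.1 p.2 = m]) fcoef f p.1 * fcoef g p.2).

Lemma fps_mulE f g m (D : seq {cmonom nat}) :
    uniq D -> (forall a b, mmul a b = m -> a \in D) ->
  fcoef (fps_mul f g) m =
  \sum_(a <- D) \sum_(b <- D)
    (if mmul a b == m then fcoef f a * fcoef g b else 0).
Proof.
move=> uD memD; rewrite /=.
transitivity (\sum_(p \in [set` [pred p : {cmonom nat} * {cmonom nat}
      | mmul p.1 p.2 == m]]) fcoef f p.1 * fcoef g p.2).
  by apply: eq_fsbigl; apply/seteqP; split=> p /eqP.
rewrite -(@bigfs _ _ _ _ [seq (a, b) | a <- D, b <- D]) ?allpairs_uniq//.
- by rewrite big_mkcond big_allpairs.
- by move=> [? ?] [? ?].
case=> a b /= /eqP ab /negP[]; apply/allpairsP; exists (a, b); split=> //=.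
  exact: memD ab.
by apply: (memD b a); rewrite mulmC.
Qed.

Fact fps_mulC : commutative fps_mul.
Proof.
move=> f g; apply: fpsP => m.
have memD a b : mmul a b = m -> a \in factors m by move=> <-; apply: factorsP.
rewrite !(fps_mulE _ _ (factors_uniq m) memD) exchange_big /=.
by apply: eq_bigr => a _; apply: eq_bigr => b _; rewrite mulmC mulrC.
Qed.

Fact fps_mul1 : left_id fps_one fps_mul.
Proof.
move=> f; apply: fpsP => m.
have memD a b : mmul a b = m -> a \in factors m by move=> <-; apply: factorsP.
rewrite (fps_mulE _ _ (factors_uniq m) memD).
rewrite (bigD1_seq mone) ?factors_uniq//=; last by apply: (memD _ m); rewrite mul1m.
rewrite [X in _ + X]big1 => [|a /negPf a1]; last first.
  by rewrite big1 // => b _; rewrite a1 mul0r if_same.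
rewrite addr0 (bigD1_seq m) ?factors_uniq//=; last by apply: (memD _ mone); rewrite mulm1.
rewrite big1 => [|b /negPf bm]; last by rewrite mul1m bm.
by rewrite mul1m !eqxx mul1r addr0.
Qed.

Fact fps_mulDl : left_distributive fps_mul +%R.
Proof.
move=> f g h; apply: fpsP => m.
have memD a b : mmul a b = m -> a \in factors m by move=> <-; apply: factorsP.
transitivity (fcoef (fps_mul f h) m + fcoef (fps_mul g h) m); last by [].
rewrite !(fps_mulE _ _ (factors_uniq m) memD) -big_split.
apply: eq_bigr => a _; rewrite -big_split; apply: eq_bigr => b _ /=.
by case: ifP => _; rewrite ?addr0 // mulrDl.
Qed.

Lemma fps_mulEl f g h m (D := factors m) :
  fcoef (fps_mul (fps_mul f g) h) m =
  \sum_(a <- D) \sum_(b <- D) \sum_(c <- D)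
    (if mmul (mmul a b) c == m then fcoef f a * fcoef g b * fcoef h c else 0).
Proof.
have memD a b : mmul a b = m -> a \in factors m by move=> <-; apply: factorsP.
rewrite (fps_mulE _ _ (factors_uniq m) memD).
transitivity (\sum_(p <- D) \sum_(c <- D) \sum_(a <- D) \sum_(b <- D)
   (if (mmul p c == m) && (mmul a b == p)
    then fcoef f a * fcoef g b * fcoef h c else 0)).
  apply: eq_bigr => p _; apply: eq_bigr => c _.
  have [pc|_] := eqVneq (mmul p c) m; last first.
    by rewrite big1 // => a _; rewrite big1.
  rewrite (fps_mulE _ _ (factors_uniq m)); last first.
    by move=> a b ab; rewrite -pc -ab factorsMl.
  rewrite mulr_suml; apply: eq_bigr => a _; rewrite mulr_suml.
  by apply: eq_bigr => b _ /=; case: ifP => _; rewrite ?mul0r.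
under eq_bigr => p _ do rewrite exchange_big.
rewrite exchange_big; apply: eq_bigr => a _.
under eq_bigr => p _ do rewrite exchange_big.
rewrite exchange_big; apply: eq_bigr => b _.
rewrite exchange_big; apply: eq_bigr => c _ /=.
have [abc|abc] := eqVneq (mmul (mmul a b) c) m.
  rewrite (bigD1_seq (mmul a b)) ?factors_uniq//=; last exact: memD abc.
  rewrite abc !eqxx /= big1 ?addr0 // => p /negPf pab.
  by rewrite [_ == p]eq_sym pab andbF.
rewrite big1 // => p _; case: ifP => // /andP[/eqP pc /eqP ab].
by case/eqP: abc; rewrite ab.
Qed.

Fact fps_one_neq0 : fps_one != 0.
Proof.
apply/eqP => /(congr1 (fun f => fcoef f mone)) /=.
by rewrite eqxx => /eqP; rewrite oner_eq0.
Qed.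

Fact fps_mulA : associative fps_mul.
Proof.
move=> f g h; rewrite fps_mulC; apply: fpsP => m; rewrite !fps_mulEl.
rewrite [LHS](eq_bigr _ (fun b _ => exchange_big _ _ _ _ _ _)) /=.
rewrite exchange_big; apply: eq_bigr => a _.
apply: eq_bigr => b _; apply: eq_bigr => c _.
by rewrite [mmul (mmul b c) a]mulmC mulmA [_ * fcoef f a]mulrC mulrA.
Qed.

HB.instance Definition _ := GRing.Zmodule_isComNzRing.Build (fps K)
  fps_mulA fps_mulC fps_mul1 fps_mulDl fps_one_neq0.

Definition fps_unit f := `[< exists g, g * f = 1 >].

Definition fps_inv f :=
  if pselect (exists g, g * f = 1) is left fV then projT1 (cid fV) else f.

Fact fps_mulVx : {in fps_unit, left_inverse 1 fps_inv *%R}.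
Proof.
move=> f; rewrite /fps_inv => /asboolP fV.
by case: pselect => // fV'; case: cid.
Qed.

Fact fps_unitPl f g : g * f = 1 -> fps_unit f.
Proof. by move=> gf; apply/asboolP; exists g. Qed.

Fact fps_inv_out : {in [predC fps_unit], fps_inv =1 id}.
Proof. by move=> f /asboolPn fV; rewrite /fps_inv; case: pselect. Qed.

HB.instance Definition _ := GRing.ComNzRing_hasMulInverse.Build (fps K)
  fps_mulVx fps_unitPl fps_inv_out.

Definition fps_scale (c : K) f := FPS (fun m => c * fcoef f m).

Fact fps_scaleA a b f : fps_scale a (fps_scale b f) = fps_scale (a * b) f.
Proof. by apply: fpsP => m /=; rewrite mulrA. Qed.
Fact fps_scale1 : left_id 1 fps_scale.
Proof. by move=> f; apply: fpsP => m /=; rewrite mul1r. Qed.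
Fact fps_scaleDr : right_distributive fps_scale +%R.
Proof. by move=> c f g; apply: fpsP => m /=; rewrite mulrDr. Qed.
Fact fps_scaleDl f : {morph fps_scale^~ f : a b / a + b}.
Proof. by move=> a b; apply: fpsP => m /=; rewrite mulrDl. Qed.

HB.instance Definition _ := GRing.Zmodule_isLmodule.Build K (fps K)
  fps_scaleA fps_scale1 fps_scaleDr fps_scaleDl.

Definition fps_monomial (m : {cmonom nat}) : fps K :=
  FPS (fun m' => (m' == m)%:R).

Definition fps_var (i : nat) : fps K := fps_monomial (ucm i).

(* Infinite sum of a family in which each monomial has a nonzero coefficient in
   only finitely many members; a coefficient where this fails is set to 0. *)
Definition fps_sum (I : choiceType) (A : set I) (F : I -> fps K) : fps K :=
  FPS (fun m => \sum_(i \in A) fcoef (F i) m).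

End FpsRing.

Section Partitions.

Definition is_part (s : seq nat) := sorted geq s && (0%N \notin s).

Record intpart := IntPart { parts :> seq nat; partsP : is_part parts }.

HB.instance Definition _ := [isSub for parts].
HB.instance Definition _ := [Choice of intpart by <:].

Definition conj_seq (s : seq nat) : seq nat :=
  [seq count (fun x => i < x)%N s | i <- iota 0 (head 0%N s)].

Fact conj_seq_part (la : intpart) : is_part (conj_seq la).
Proof.
apply/andP; split.
  rewrite sorted_map; apply: (@sub_sorted _ leq); last exact: iota_sorted.
  by move=> i j ij; apply: sub_count => x /=; apply: leq_ltn_trans.
apply/mapP; case=> i; rewrite /conj_seq; case: (parts la) => [|x s] //=.
by rewrite mem_iota /= => ->.
Qed.

Definition conj_part (la : intpart) : intpart := IntPart (conj_seq_part la).

(* y_1^{la_1} y_2^{la_2} ... *)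
Definition part_monomial (la : seq nat) : {cmonom nat} :=
  \big[mmul/mone]_(0 <= i < size la) expcmn (ucm i) (nth 0%N la i).

Lemma part_monomialE la i : part_monomial la i = nth 0%N la i.
Proof.
have expE m k j : expcmn m k j = (k * m j)%N :> nat.
  rewrite /expcmn; case: k => [|k]; first by rewrite onecmE.
  rewrite iteropS; elim: k => [|k IHk]; first by rewrite mul1n.
  by rewrite iterS mulcmE IHk -mulSn.
have -> : part_monomial la i =
    (\sum_(0 <= j < size la) (nth 0 la j * (j == i)))%N.
  rewrite /part_monomial.
  elim/big_rec2: _ => [|j k m _ IHm]; first by rewrite cm1.
  by rewrite cmM IHm expE cmU.
have [ila|ila] := ltnP i (size la).
  rewrite (bigD1_seq i) ?mem_index_iota ?iota_uniq//= eqxx muln1.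
  by rewrite big1 ?addn0 // => j /negPf ->; rewrite muln0.
rewrite nth_default // big_nat big1 // => j /andP[_ jla].
by rewrite ltn_eqF ?muln0 // (leq_trans jla ila).
Qed.

Lemma part_monomial_inj : injective (fun la : intpart => part_monomial la).
Proof.
have size_part (la : intpart) i : (i < size la)%N = (0 < nth 0%N la i)%N.
  have [ila|ila] := ltnP i (size la); last by rewrite nth_default.
  have /andP[_ la0] := partsP la.
  by rewrite lt0n; apply/esym/eqP => i0; case/negP: la0; rewrite -i0 mem_nth.
move=> la mu eq_m; apply/val_inj/(@eq_from_nth _ 0%N) => /= [|i _].
  have lt_size i : (i < size la)%N = (i < size mu)%N.
    by rewrite !size_part -!part_monomialE; move: eq_m => /= ->.
  by apply/eqP; rewrite eqn_leq leqNgt lt_size ltnn leqNgt -lt_size ltnn.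
by rewrite -!part_monomialE; move: eq_m => /= ->.
Qed.

End Partitions.

(* The map y^la |-> q^{la'}, extended to infinite linear combinations. Its
   domain C[[y_1, y_1 y_2, ...]] consists of the series supported on the
   monomials y^la; coefficients at other monomials are ignored. *)
Definition conj_map (K : comNzRingType) (f : fps K) : fps K :=
  fps_sum [set: intpart] (fun la =>
    fcoef f (part_monomial la) *: fps_monomial K (part_monomial (conj_part la))).

Lemma conj_map_monomial (K : comNzRingType) (la : intpart) :
  conj_map (fps_monomial K (part_monomial la)) =
  fps_monomial K (part_monomial (conj_part la)).
Proof.
apply: fpsP => m /=.
rewrite (fsbigTE [fset la]%fset) ?big_seq_fset1 /= ?eqxx ?mul1r // => mu.
rewrite inE => mu_la; case: eqP => [/part_monomial_inj|_]; rewrite ?mul0r //.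
by move=> eq_mu; rewrite eq_mu eqxx in mu_la.
Qed.

Section Tableaux.

(* Cells (i, j) of the diagram in English notation, numbered from 0. *)
Definition cell (la : seq nat) := {i : 'I_(size la) & 'I_(nth 0%N la i)}.
HB.instance Definition _ la := Finite.on (cell la).

Definition cell_row la (x : cell la) : nat := tag x.
Definition cell_col la (x : cell la) : nat := tagged x.

Definition left_of la (x y : cell la) :=
  (cell_row x == cell_row y) && (cell_col x < cell_col y)%N.
Definition above la (x y : cell la) :=
  (cell_col x == cell_col y) && (cell_row x < cell_row y)%N.

Definition is_ssyt la (T : {ffun cell la -> nat}) :=
  [forall x, forall y, (left_of x y ==> (T x <= T y)%N)
                    && (above x y ==> (T x < T y)%N)].

(* The Schur function at the sequence z_0, z_1, ..., where z may contain
   the constant 1. *)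
Definition schur (K : comNzRingType) (la : intpart) (z : nat -> fps K) : fps K :=
  fps_sum [set T : {ffun cell la -> nat} | is_ssyt T]
          (fun T => \prod_(x : cell la) z (T x)).

Variables (r : nat) (la : 'I_r -> intpart).

Definition mcell := {k : 'I_r & cell (la k)}.
HB.instance Definition _ := Finite.on mcell.

Definition component (x : mcell) : nat := tag x.

(* Each component of the diagram occupies the rows directly below those of the
   previous component. *)
Definition mrow (x : mcell) : nat :=
  ((\sum_(k < r | k < tag x) size (la k)) + cell_row (tagged x))%N.

Variable n : nat.
Implicit Types (T : {ffun mcell -> 'I_n}) (i : 'I_n).

(* The value v : 'I_n stands for the entry v + 1. *)
Definition is_syt T :=
  [forall i, #|[set x | T x == i]%SET| == 1%N] &&
  [forall k, forall x : cell (la k), forall y : cell (la k),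
    (left_of x y || above x y) ==>
    (T (Tagged (fun k => cell (la k)) x) < T (Tagged (fun k => cell (la k)) y))%N].

Definition is_descent T i :=
  [exists x, exists y, [&& T x == i, T y == i.+1 :> nat & (mrow x < mrow y)%N]].

Definition syt_d T i : nat :=
  #|[set j : 'I_n | is_descent T j && (i <= j)%N]%SET|.

Definition syt_c T i : nat := if [pick x | T x == i] is Some x then component x else 0%N.

Definition syt_f T i : nat := (r * syt_d T i + syt_c T i)%N.

End Tableaux.

(* The m-th term y_1 y_2 ... y_{j + m r} of the sequence z^j. *)
Definition zseq (K : comNzRingType) (r j m : nat) : fps K :=
  \prod_(i < j + m * r) fps_var K i.

(* Main.v *)
Require Import Defs.
From HB Require Import structures.
From mathcomp Require Import all_boot all_order all_algebra finmap monalg.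
From mathcomp Require Import boolp classical_sets cardinality fsbigop reals.
From mathcomp Require Import complex perm zify.

Set Implicit Arguments.
Unset Strict Implicit.
Unset Printing Implicit Defensive.

Import GRing.Theory.
Local Open Scope ring_scope.

(** Expand the product of Schur functions over fillings [h] of all the cells
    of the r-tuple of diagrams. A cell x of component k with entry c = h x
    contributes y_1 y_2 ... y_v with v = k + r c, so the whole filling
    contributes y^mu, where mu is the conjugate of the partition formed by the
    numbers v; the conjugation map therefore sends it to q_1^(v_1) q_2^(v_2) ...,
    where v_1 >= v_2 >= ... are these numbers in decreasing order
    ([conj_map_prod_sorted]).

    Since the values are listed in decreasing order while standard tableaux
    increase along rows and columns, the fillings have to be reversed: as Schur
    functions are symmetric, one may sum over the fillings whose rows weakly
    decrease and whose columns strictly decrease ([schur_rssyt], from the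
    Bender-Knuth involution [bk]).

    Such a filling h is then standardized: list the cells by decreasing entry
    and, among equal entries, from the lowest row to the highest and from left
    to right within a row. The positions in this list form a standard Young
    r-tableau T, and the fillings that lead to a given T are exactly the
    h that weakly decrease along T and strictly decrease at every descent of T
    ([sum_mrssyt]). This is the fundamental lemma of the theory of P-partitions.
    An entry of T followed by one in a later component is a descent, so the
    numbers v decrease along T as well ([conj_map_descent_compat]), and h
    contributes the product of the q_i^(c_i(T) + r h_i), where h_i is the value
    of h at the i-th cell.

    Finally, h decreases along T with strict drops at the descents exactly when
    h_i is the sum of the k_j with j >= i plus the number of descents j >= i, for
    a unique sequence of natural numbers k_j. The exponent of q_i becomes f_i(T)
    plus r times the sum of the k_j with j >= i ([syt_fE]), so the sum over all
    k is q_1^(f_1(T)) ... q_n^(f_n(T)) times a product of n geometric series in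
    the monomials (q_1 ... q_j)^r ([eqtrunc_descent_compat], [prod_prefix]).

    Infinite sums are avoided throughout: two series are equal as soon as they
    agree in all degrees below N, for every N, and up to degree N only the
    fillings with entries at most N matter. *)

(** * Series modulo high degree *)

Section Truncation.
Variable K : comNzRingType.
Implicit Types (f g : fps K) (a b m : {cmonom nat}) (N : nat).

(** Congruence modulo the ideal of the series of order at least N. *)
Definition eqtrunc N f g :=
  forall m, (mdeg m < N)%N -> fcoef f m = fcoef g m.

Lemma eqtrunc_refl N f : eqtrunc N f f. Proof. by []. Qed.

Lemma eqtrunc_sym N f g : eqtrunc N f g -> eqtrunc N g f.
Proof. by move=> fg m /fg. Qed.

Lemma eqtrunc_trans N g f h : eqtrunc N f g -> eqtrunc N g h -> eqtrunc N f h.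
Proof. by move=> fg gh m mN; rewrite fg ?gh. Qed.

Lemma eqtruncW N N' f g : (N' <= N)%N -> eqtrunc N f g -> eqtrunc N' f g.
Proof. by move=> N'N fg m mN'; apply/fg/(leq_trans mN'). Qed.

Lemma eqtrunc_eq f g : (forall N, eqtrunc N f g) -> f = g.
Proof. by move=> fg; apply: fpsP => m; apply: (fg (mdeg m).+1). Qed.

Lemma fcoef0 m : fcoef (0 : fps K) m = 0. Proof. by []. Qed.

Lemma fcoefD f g m : fcoef (f + g) m = fcoef f m + fcoef g m.
Proof. by []. Qed.

Lemma fcoef_sum (I : Type) (r : seq I) (P : pred I) (F : I -> fps K) m :
  fcoef (\sum_(i <- r | P i) F i) m = \sum_(i <- r | P i) fcoef (F i) m.
Proof. exact: (big_morph (fun f => fcoef f m)). Qed.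

(** The factors of a monomial of degree less than N have degree less than N. *)
Lemma eqtrunc_mul N f f' g g' :
  eqtrunc N f f' -> eqtrunc N g g' -> eqtrunc N (f * g) (f' * g').
Proof.
move=> ff' gg' m mN.
have memD a b : mmul a b = m -> a \in factors m by move=> <-; apply: factorsP.
rewrite !(fps_mulE _ _ (factors_uniq m) memD).
apply: eq_bigr => a _; apply: eq_bigr => b _; case: eqP => // abm.
by rewrite -abm mdegM in mN; rewrite ff' ?gg' //; lia.
Qed.

Lemma eqtrunc_sum N (I : Type) (r : seq I) (P : pred I) (F G : I -> fps K) :
    (forall i, P i -> eqtrunc N (F i) (G i)) ->
  eqtrunc N (\sum_(i <- r | P i) F i) (\sum_(i <- r | P i) G i).
Proof.
by move=> FG m mN; rewrite !fcoef_sum; apply: eq_bigr => i Pi; apply: FG.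
Qed.

Lemma eqtrunc_prod N (I : Type) (r : seq I) (P : pred I) (F G : I -> fps K) :
    (forall i, P i -> eqtrunc N (F i) (G i)) ->
  eqtrunc N (\prod_(i <- r | P i) F i) (\prod_(i <- r | P i) G i).
Proof.
move=> FG; elim/big_rec2: _ => [|i f g Pi fg]; first exact: eqtrunc_refl.
by apply: eqtrunc_mul => //; apply: FG.
Qed.

(** * Monomials *)

Lemma fps_monomialM a b :
  fps_monomial K (mmul a b) = fps_monomial K a * fps_monomial K b.
Proof.
apply: fpsP => m /=; have [->|/eqP mab] := eqVneq m (mmul a b).
  rewrite (fsbigE [:: (a, b)]) //=.
  - by rewrite big_cons big_nil mem_set //= !eqxx mulr1 addr0.
  - by move=> p; rewrite /= inE => /eqP ->.
  move=> [c d] _; rewrite inE; case: (eqVneq c a) => [->|_]; rewrite ?mul0r //.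
  by case: (eqVneq d b) => [->|_]; rewrite ?mulr0 // eqxx.
rewrite fsbig1 //= => -[c d] /= cdm.
case: eqP => [ca|_]; rewrite ?mul0r //.
by case: eqP => [db|_]; rewrite ?mulr0 //; case: mab; rewrite -ca -db cdm.
Qed.

Lemma fps_monomial_prod (I : Type) (r : seq I) (P : pred I) F :
  \prod_(i <- r | P i) fps_monomial K (F i) =
  fps_monomial K (\big[mmul/mone]_(i <- r | P i) F i).
Proof. by apply/esym/(big_morph _ fps_monomialM). Qed.

Lemma expcmnE a k i : expcmn a k i = (k * a i)%N :> nat.
Proof.
rewrite /expcmn; case: k => [|k]; first by rewrite onecmE.
rewrite iteropS; elim: k => [|k IHk]; first by rewrite mul1n.
by rewrite iterS mulcmE IHk -mulSn.
Qed.

Lemma expcmnS a k : expcmn a k.+1 = mmul a (expcmn a k).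
Proof. by apply/eqP/cmP => i; rewrite cmM !expcmnE mulSn. Qed.

Lemma fps_monomialX a k : fps_monomial K (expcmn a k) = fps_monomial K a ^+ k.
Proof.
elim: k => [|k IHk] //.
by rewrite expcmnS fps_monomialM IHk exprS.
Qed.

Lemma mdeg_expcmn a k : mdeg (expcmn a k) = (k * mdeg a)%N.
Proof.
elim: k => [|k IHk]; first by rewrite mdeg1.
by rewrite expcmnS mdegM IHk mulSn.
Qed.

Lemma mdeg_part_monomial (s : seq nat) : mdeg (part_monomial s) = sumn s.
Proof.
rewrite /part_monomial mdeg_prod sumnE [RHS](big_nth 0%N).
by apply: eq_bigr => i _; rewrite mdeg_expcmn mdegU muln1.
Qed.

Lemma part_monomial_eq (s t : seq nat) :
  (forall i, nth 0%N s i = nth 0%N t i) -> part_monomial s = part_monomial t.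
Proof. by move=> st; apply/eqP/cmP => i; rewrite !part_monomialE. Qed.

Lemma prod_fps_var n (e : 'I_n -> nat) :
  \prod_(i < n) fps_var K i ^+ e i =
  fps_monomial K (part_monomial [seq e i | i <- enum 'I_n]).
Proof.
rewrite /part_monomial size_map size_enum_ord big_mkord -fps_monomial_prod.
apply: eq_bigr => i _.
by rewrite (nth_map i) ?size_enum_ord // nth_ord_enum fps_monomialX.
Qed.

Lemma zseqE r j c :
  zseq K r j c = fps_monomial K (part_monomial (nseq (j + c * r) 1%N)).
Proof.
rewrite /zseq (eq_bigr (fun i : 'I__ => fps_var K i ^+ 1)) => [|i _]; last first.
  by rewrite expr1.
rewrite prod_fps_var; congr (fps_monomial K (part_monomial _)).
have /all_pred1P -> : all (pred1 1%N) [seq 1%N | _ <- enum 'I_(j + c * r)].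
  by apply/allP => _ /mapP[i _ ->] /=.
by rewrite size_map size_enum_ord.
Qed.

Lemma eqtrunc_monomial0 N a : (N <= mdeg a)%N -> eqtrunc N (fps_monomial K a) 0.
Proof.
by move=> Na m mN /=; case: eqP => // ma; rewrite -ma leqNgt mN in Na.
Qed.

(** * Geometric series *)

(** The inverse is the geometric series; its coefficient at m can be read off
    the partial sum up to exponent mdeg m, as higher powers have larger degree. *)
Lemma one_sub_monomial_unit a : (0 < mdeg a)%N ->
  1 - fps_monomial K a \is a GRing.unit.
Proof.
set e := fps_monomial K a => a_gt0.
have eN N k : (N <= k)%N -> eqtrunc N (e ^+ k) 0.
  move=> Nk; rewrite -fps_monomialX; apply: eqtrunc_monomial0.
  by rewrite mdeg_expcmn; nia.
pose g := FPS (fun m => fcoef (\sum_(k < (mdeg m).+1) e ^+ k) m).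
have gE N : eqtrunc N g (\sum_(k < N) e ^+ k).
  move=> m mN; rewrite /= -!(big_mkord xpredT (fun k => e ^+ k)).
  rewrite [in RHS](big_cat_nat _ mN) // fcoefD !fcoef_sum.
  rewrite [X in _ + X]big_nat [X in _ + X]big1 ?addr0 // => k /andP[mk _].
  exact: (eN _ _ mk).
suff g1 : g * (1 - e) = 1 by apply/asboolP; exists g.
apply: eqtrunc_eq => N.
apply: (eqtrunc_trans (g := (\sum_(k < N) e ^+ k) * (1 - e))).
  exact/eqtrunc_mul/eqtrunc_refl.
rewrite mulrC -opprB mulNr -subrX1 opprB => m mN.
rewrite fcoefD -[X in _ + X]/(- fcoef (e ^+ N) m) (eN N N (leqnn N) m mN).
by rewrite fcoef0 subr0.
Qed.

(** The error is (1 - e)^-1 e^N, of order at least N. *)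
Lemma eqtrunc_geometric N a : (0 < mdeg a)%N ->
  eqtrunc N (1 - fps_monomial K a)^-1
            (\sum_(k < N) fps_monomial K (expcmn a k)).
Proof.
move=> a_gt0; have Ue := one_sub_monomial_unit a_gt0.
set e := fps_monomial K a in Ue *.
have -> : \sum_(k < N) fps_monomial K (expcmn a k) = (1 - e)^-1 * (1 - e ^+ N).
  under eq_bigr do rewrite fps_monomialX.
  by rewrite -[1 - e ^+ N]opprB subrX1 -mulNr opprB mulKr.
rewrite -[X in eqtrunc _ X _]mulr1; apply: eqtrunc_mul => // m mN.
rewrite fcoefD -[X in _ + X]/(- fcoef (e ^+ N) m) -fps_monomialX.
rewrite (@eqtrunc_monomial0 N _ _ m mN) ?fcoef0 ?subr0 //.
by rewrite mdeg_expcmn; nia.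
Qed.

End Truncation.

(** * The conjugation map *)

Section Conjugation.
Variable K : comNzRingType.
Implicit Types (f g : fps K) (s : seq nat) (la : intpart).

Lemma sorted_geq_cons x s y : sorted geq (x :: s) -> y \in s -> (y <= x)%N.
Proof.
rewrite /= (path_sortedE (fun _ _ _ xy yz => leq_trans yz xy)).
by case/andP => /allP le_x _ /le_x.
Qed.

(** Extends the defining formula of [conj_seq] past its end, where both sides
    vanish. *)
Lemma nth_conj_seq s i : sorted geq s -> nth 0%N (conj_seq s) i = count (ltn i) s.
Proof.
move=> s_dec; have [ih|hi] := ltnP i (head 0%N s).
  by rewrite (nth_map 0%N) ?size_iota // nth_iota.
rewrite nth_default ?size_map ?size_iota //; apply/esym/eqP.
rewrite -leqn0 leqNgt -has_count; apply/hasPn => x xs; rewrite -leqNgt.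
apply: leq_trans hi; case: s s_dec xs => //= y s /sorted_geq_cons le_y.
by rewrite inE => /predU1P[->//|/le_y].
Qed.

(** Both inequalities say that the cell (j, i) lies in the diagram of [s]; this
    is the symmetry behind the involutivity of conjugation. *)
Lemma count_gt_sorted s i j : sorted geq s ->
  (j < count (ltn i) s)%N = (i < nth 0%N s j)%N.
Proof.
elim: s j => [|x s IHs] j s_dec; first by rewrite nth_nil.
have {}IHs := IHs ^~ (path_sorted s_dec).
have [xi|xi] := leqP x i; last by case: j => [|j] /=; rewrite xi // -IHs.
have -> : count (ltn i) (x :: s) = 0%N.
  apply/eqP; rewrite -leqn0 leqNgt -has_count -all_predC /=.
  rewrite -leqNgt xi; apply/allP => y /(sorted_geq_cons s_dec) yx /=.
  by rewrite -leqNgt (leq_trans yx).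
rewrite ltn0; apply/esym/negbTE; rewrite -leqNgt.
case: j => // j /=; have [js|js] := ltnP j (size s); last by rewrite nth_default.
exact: leq_trans (sorted_geq_cons s_dec (mem_nth _ js)) xi.
Qed.

Lemma conj_seq_is_part s : is_part (conj_seq s).
Proof.
apply/andP; split.
  rewrite sorted_map; apply: (@sub_sorted _ leq); last exact: iota_sorted.
  by move=> i j ij; apply: sub_count => x /=; apply: leq_ltn_trans.
apply/mapP; case=> i; rewrite /conj_seq; case: s => [|x s] //=.
by rewrite mem_iota /= => ->.
Qed.

(** Trailing zeros are allowed in [s] and are lost by conjugation, hence a
    statement about the entries only. *)
Lemma conj_seqK s i : sorted geq s ->
  nth 0%N (conj_seq (conj_seq s)) i = nth 0%N s i.
Proof.
move=> s_dec; have /andP[cs_dec _] := conj_seq_is_part s.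
rewrite nth_conj_seq //.
have lt_j j : (j < count (ltn i) (conj_seq s))%N = (j < nth 0%N s i)%N.
  by rewrite count_gt_sorted // nth_conj_seq // count_gt_sorted.
have := lt_j (nth 0%N s i); have := lt_j (count (ltn i) (conj_seq s)).
by rewrite !ltnn; lia.
Qed.

Lemma part_monomial_conjK la :
  part_monomial (conj_seq (conj_seq la)) = part_monomial la.
Proof.
by apply: part_monomial_eq => i; rewrite conj_seqK //; case/andP: (partsP la).
Qed.

Lemma conj_partK : involutive conj_part.
Proof. by move=> la; apply/part_monomial_inj/part_monomial_conjK. Qed.

Lemma sumn_conj_seq s : sorted geq s -> sumn (conj_seq s) = sumn s.
Proof.
move=> s_dec; rewrite sumnE big_map.
under eq_bigr do rewrite -sum1_count big_mkcond.
rewrite exchange_big /= sumnE big_seq [RHS]big_seq; apply: eq_bigr => x xs.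
have x_le : (x <= head 0%N s)%N.
  case: s s_dec xs => //= y s /sorted_geq_cons le_y.
  by rewrite inE => /predU1P[->//|/le_y].
rewrite -(subnKC x_le) iotaD big_cat /=.
rewrite [X in (X + _)%N]big_seq [X in (_ + X)%N]big_seq.
rewrite [X in (_ + X)%N]big1 ?addn0 => [|i]; last first.
  by rewrite mem_iota add0n => /andP[xi _]; rewrite ltnNge xi.
under eq_bigr => i do [rewrite mem_iota add0n /= => ->].
by rewrite -big_seq sum1_size size_iota.
Qed.

(** Conjugation is an involution, so every coefficient of [conj_map f] is a
    single coefficient of [f]. This makes linearity and compatibility with
    truncation immediate. *)
Lemma fcoef_conj_map f la :
  fcoef (conj_map f) (part_monomial la) = fcoef f (part_monomial (conj_part la)).
Proof.
rewrite /= (fsbigTE [fset conj_part la]%fset) ?big_seq_fset1 /=.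
  by rewrite part_monomial_conjK eqxx mulr1.
move=> mu; rewrite inE => mu_la; 
  case: eqP => [/(@part_monomial_inj la (conj_part mu)) lamu|_].
  by rewrite lamu conj_partK eqxx in mu_la.
by rewrite mulr0.
Qed.

Lemma fcoef_conj_map0 f m : (forall la, part_monomial la <> m) ->
  fcoef (conj_map f) m = 0.
Proof.
move=> m_la /=; rewrite fsbig1 // => la _.
by case: eqP => [mla|_]; rewrite ?mulr0 //; case: (m_la (conj_part la)).
Qed.

Lemma eqtrunc_conj_map N f g :
  eqtrunc N f g -> eqtrunc N (conj_map f) (conj_map g).
Proof.
move=> fg m mN; case: (pselect (exists la : intpart, part_monomial la = m)).
  move=> [la lam]; rewrite -lam !fcoef_conj_map; apply: fg.
  rewrite mdeg_part_monomial /= sumn_conj_seq -?mdeg_part_monomial ?lam //.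
  by case/andP: (partsP la).
by move=> m_la; rewrite !fcoef_conj_map0 // => la lam; apply: m_la; exists la.
Qed.

Lemma conj_map_sum (I : Type) (r : seq I) (P : pred I) (F : I -> fps K) :
  conj_map (\sum_(i <- r | P i) F i) = \sum_(i <- r | P i) conj_map (F i).
Proof.
apply: fpsP => m; rewrite fcoef_sum.
case: (pselect (exists la : intpart, part_monomial la = m)) => [[la <-]|m_la].
  by rewrite fcoef_conj_map fcoef_sum; apply: eq_bigr => i _; rewrite fcoef_conj_map.
have {}m_la la : part_monomial (parts la) <> m by move=> lam; apply: m_la; exists la.
by rewrite fcoef_conj_map0 // big1 // => i _; rewrite fcoef_conj_map0.
Qed.

(** The exponent of y_(i+1) in the product is the number of the v that exceed
    i, so the product is y^mu with mu the conjugate of [s]. *)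
Lemma conj_map_prod_sorted s : sorted geq s ->
  conj_map (\prod_(v <- s) fps_monomial K (part_monomial (nseq v 1%N))) =
  fps_monomial K (part_monomial s).
Proof.
move=> s_dec; pose la := IntPart (conj_seq_is_part s).
rewrite fps_monomial_prod (_ : \big[_/_]_(v <- s) _ = part_monomial la).
  rewrite conj_map_monomial; congr fps_monomial; apply: part_monomial_eq => i.
  exact: conj_seqK.
apply/eqP/cmP => i; rewrite part_monomialE nth_conj_seq // -sum1_count.
rewrite (big_morph (fun m : {cmonom nat} => m i) (cmM i) (cm1 i)) [RHS]big_mkcond.
by apply: eq_bigr => v _; rewrite part_monomialE nth_nseq.
Qed.

End Conjugation.

(** * Semistandard tableaux with bounded entries *)

Section BoundedTableaux.
Variable la : seq nat.

Definition mkcell i j (ilt : (i < size la)%N) (jlt : (j < nth 0 la i)%N) :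
  cell la := Tagged (fun i : 'I_(size la) => 'I_(nth 0%N la i))
                    (Ordinal jlt : 'I_(nth 0%N la (Ordinal ilt))).

Lemma cell_col_lt (x : cell la) : (cell_col x < nth 0 la (cell_row x))%N.
Proof. by case: x => i j /=; apply: ltn_ord. Qed.

Lemma cell_inj (x y : cell la) :
  cell_row x = cell_row y -> cell_col x = cell_col y -> x = y.
Proof.
case: x y => i j [i' j'] /val_inj /= ii'; subst i'.
by move=> /val_inj /= ->.
Qed.

Lemma is_ssytP (T : {ffun cell la -> nat}) :
  reflect (forall x y, (left_of x y -> (T x <= T y)%N) /\
                       (above x y -> (T x < T y)%N))
          (is_ssyt T).
Proof.
apply: (iffP forallP) => [T_ssyt x y|T_ssyt x].
  by have /forallP/(_ y)/andP[/implyP ? /implyP ?] := T_ssyt x.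
by apply/forallP => y; have [? ?] := T_ssyt x y; apply/andP; split; apply/implyP.
Qed.

Definition ssyt N (t : {ffun cell la -> 'I_N}) :=
  is_ssyt [ffun x => nat_of_ord (t x)].

(** Reversing the alphabet turns semistandard tableaux into the fillings with
    weakly decreasing rows and strictly decreasing columns. *)
Definition rssyt N (t : {ffun cell la -> 'I_N}) :=
  ssyt [ffun x => rev_ord (t x)].

Lemma ssytP N (t : {ffun cell la -> 'I_N}) :
  reflect (forall x y, (left_of x y -> (t x <= t y)%N) /\
                       (above x y -> (t x < t y)%N))
          (ssyt t).
Proof.
by apply: (iffP (is_ssytP _)) => ht x y; have [] := ht x y; rewrite !ffunE.
Qed.

Lemma rssytP N (t : {ffun cell la -> 'I_N}) :
  reflect (forall x y, (left_of x y -> (t y <= t x)%N) /\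
                       (above x y -> (t y < t x)%N))
          (rssyt t).
Proof.
apply: (iffP (ssytP _)) => ht x y; have [hl ha] := ht x y.
  move: hl ha; rewrite !ffunE /= => hl ha.
  by split=> xy; [have := hl xy|have := ha xy]; have := ltn_ord (t x);
    have := ltn_ord (t y); lia.
rewrite !ffunE /=; split=> xy; [have := hl xy|have := ha xy];
  by have := ltn_ord (t x); have := ltn_ord (t y); lia.
Qed.

End BoundedTableaux.

Section SchurTruncation.
Variables (K : comNzRingType) (la : intpart).

(** Since [z a] has order at least a, a tableau with an entry at least N
    contributes nothing in degree less than N. *)
Lemma eqtrunc_schur (z : nat -> fps K) N :
    (forall a, eqtrunc a (z a) 0) ->
  eqtrunc N (schur la z)
    (\sum_(t : {ffun cell la -> 'I_N} | ssyt t) \prod_x z (t x)).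
Proof.
move=> z_ord m mN; rewrite fcoef_sum /=.
pose nat_tab (t : {ffun cell la -> 'I_N}) := [ffun x => nat_of_ord (t x)].
transitivity (\sum_(T <- [seq nat_tab t | t : {ffun cell la -> 'I_N}] | is_ssyt T)
    fcoef (\prod_x z (T x)) m); last first.
  rewrite big_map big_enum_cond /=; apply: eq_bigr => t _.
  by congr fcoef; apply: eq_bigr => x _; rewrite ffunE.
rewrite [RHS]bigfs ?map_inj_uniq -?enumT ?enum_uniq //.
  move=> t u /ffunP tu; apply/ffunP => x; apply: val_inj.
  by have := tu x; rewrite !ffunE.
move=> T _ T_out; have [/forallP T_lt|] := boolP [forall x, (T x < N)%N].
  case/negP: T_out; apply/mapP.
  exists [ffun x => Ordinal (T_lt x)]; first by rewrite mem_enum.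
  by apply/ffunP => x; rewrite !ffunE.
rewrite negb_forall => /existsP[x]; rewrite -leqNgt => NT.
have /(_ m mN) -> // : eqtrunc N (\prod_x z (T x)) 0.
rewrite (bigD1 x) //= -[X in eqtrunc _ _ X](mul0r (\prod_(y | y != x) z (T y))).
by apply: eqtrunc_mul; [apply: eqtruncW (z_ord _)|apply: eqtrunc_refl].
Qed.

End SchurTruncation.

(** * Row counts of a tableau *)

Section RowCounts.
Variables (la : intpart) (N : nat).
Implicit Types (t : {ffun cell la -> 'I_N}) (b i : nat) (x y : cell la).

(** In a semistandard tableau this is the number of entries smaller than b in
    row i: by [row_countP] these entries fill exactly that many first cells.
    The entries equal to b in row i thus occupy the columns from
    [row_count t b i] to [row_count t b.+1 i], excluded. *)
Definition row_count t b i :=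
  \max_(x : cell la | (cell_row x == i) && (t x < b)%N) (cell_col x).+1.

Lemma nth_part_le i i' : (i <= i')%N -> (nth 0 la i' <= nth 0 la i)%N.
Proof.
move=> ii'; have /andP[la_dec _] := partsP la.
have [ila|ila] := ltnP i' (size la); last by rewrite nth_default.
have geq_trans : transitive geq by move=> u v w vu uw; apply: leq_trans uw vu.
apply: (sorted_leq_nth geq_trans leqnn 0%N la_dec) => //; rewrite inE //.
exact: leq_ltn_trans ila.
Qed.

Lemma nth_part_size i c : (c < nth 0 la i)%N -> (i < size la)%N.
Proof. by move=> c_lt; case: ltnP => // ila; rewrite nth_default in c_lt. Qed.

Lemma ex_cell i c : (c < nth 0 la i)%N ->
  exists x : cell la, cell_row x = i /\ cell_col x = c.
Proof. by move=> c_lt; exists (mkcell (nth_part_size c_lt) c_lt). Qed.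

Lemma row_count_le t b i : (row_count t b i <= nth 0 la i)%N.
Proof. by apply/bigmax_leqP => x /andP[/eqP <- _]; apply: cell_col_lt. Qed.

Lemma row_countP t b x : ssyt t ->
  (t x < b)%N = (cell_col x < row_count t b (cell_row x))%N.
Proof.
move=> /ssytP t_ssyt; apply/idP/idP => [tb|].
  by apply: (@leq_bigmax_cond _ _ (fun y => (cell_col y).+1) x); rewrite eqxx.
apply: contraLR; rewrite -!leqNgt => b_le; apply/bigmax_leqP.
move=> y /andP[/eqP ry ty]; rewrite ltnNge; apply/negP.
rewrite leq_eqVlt => /predU1P[cxy|cxy].
  by rewrite -(cell_inj (esym ry) cxy) ltnNge b_le in ty.
by have [/(_ _)] := t_ssyt x y; rewrite /left_of ry eqxx cxy => /(_ isT); lia.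
Qed.

Lemma row_count_uniq t b i c : ssyt t -> (c <= nth 0 la i)%N ->
    (forall x, cell_row x = i -> (t x < b)%N = (cell_col x < c)%N) ->
  row_count t b i = c.
Proof.
move=> t_ssyt c_le tc; have r_le := row_count_le t b i.
case: (ltngtP (row_count t b i) c) => // [rc|cr].
  have [x [rx cx]] := ex_cell (leq_trans rc c_le).
  by have := tc _ rx; rewrite row_countP // rx cx ltnn rc.
have [x [rx cx]] := ex_cell (leq_trans cr r_le).
by have := tc _ rx; rewrite row_countP // rx cx ltnn cr.
Qed.

Lemma row_count_mono t b b' i : ssyt t -> (b <= b')%N ->
  (row_count t b i <= row_count t b' i)%N.
Proof.
move=> t_ssyt bb'; rewrite leqNgt; apply/negP => r'r.
have [x [rx cx]] := ex_cell (leq_trans r'r (row_count_le t b i)).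
have := row_countP b x t_ssyt; have := row_countP b' x t_ssyt; rewrite rx cx ltnn r'r.
by lia.
Qed.

(** Below an entry at least b there can only be entries at least b + 1. *)
Lemma row_count_above t b i : ssyt t -> (row_count t b.+1 i.+1 <= row_count t b i)%N.
Proof.
move=> t_ssyt; rewrite leqNgt; apply/negP => r'r.
have c_lt := leq_trans r'r (row_count_le t b.+1 i.+1).
have [y [ry cy]] := ex_cell c_lt.
have [x [rx cx]] := ex_cell (leq_trans c_lt (nth_part_le (leqnSn i))).
have [_ /(_ _)] := ssytP _ t_ssyt x y.
rewrite /above rx ry cx cy eqxx ltnSn => /(_ isT).
have := row_countP b x t_ssyt; have := row_countP b.+1 y t_ssyt.
by rewrite rx ry cx cy ltnn r'r; lia.
Qed.

Lemma sum_cells (F : nat -> nat -> nat) :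
  (\sum_(x : cell la) F (cell_row x) (cell_col x) =
   \sum_(i < size la) \sum_(j < nth 0 la i) F i j)%N.
Proof. by rewrite sig_big_dep. Qed.

Lemma sum_interval p q n : (p <= q <= n)%N -> (\sum_(j < n) (p <= j < q) = q - p)%N.
Proof.
move=> /andP[pq qn].
rewrite -(big_mkord xpredT (fun j => (p <= j < q) : nat)).
rewrite (big_cat_nat (n := p)) //=; last exact: leq_trans qn.
rewrite [X in (X + _)%N]big_nat big1 ?add0n => [|j]; last first.
  by case/andP => _ jp; rewrite leqNgt jp.
rewrite (big_cat_nat (n := q)) //= [X in (_ + X)%N]big_nat.
rewrite [X in (_ + X)%N]big1 ?addn0 => [|j]; last first.
  by case/andP => qj _; rewrite ltnNge qj andbF.
rewrite (eq_big_nat _ _ (F2 := fun=> 1%N)) => [|j ->] //.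
by rewrite sum_nat_const_nat muln1.
Qed.

Lemma card_entries t b : ssyt t ->
  (#|[set x | t x == b :> nat]%SET| =
   \sum_(i < size la) (row_count t b.+1 i - row_count t b i))%N.
Proof.
move=> t_ssyt; rewrite -sum1_card big_mkcond /=.
transitivity (\sum_(x : cell la)
    (row_count t b (cell_row x) <= cell_col x < row_count t b.+1 (cell_row x)))%N.
  apply: eq_bigr => x _; rewrite inE leqNgt -!row_countP //.
  by rewrite -leqNgt ltnS eqn_leq andbC; case: (_ && _).
rewrite (sum_cells (fun i j => (row_count t b i <= j < row_count t b.+1 i) : nat)).
by apply: eq_bigr => i _; rewrite sum_interval // row_count_mono //= row_count_le.
Qed.

End RowCounts.

(** * The Bender-Knuth involution *)

Section BenderKnuth.
Variables (la : intpart) (N a : nat).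
Hypothesis aN : (a.+1 < N)%N.
Implicit Types (t : {ffun cell la -> 'I_N}) (b i : nat) (x y : cell la).

(** With all the entries other than a and a + 1 fixed, the tableau is
    determined by the number q_i of entries less than a + 1 in each row i, and the conditions on rows and columns say that each q_i lies,
    independently of the others, between [bk_lo t i] and [bk_hi t i]. The
    involution reflects every q_i in its interval. *)
Definition bk_lo t i := maxn (row_count t a i) (row_count t a.+2 i.+1).
Definition bk_hi t i :=
  if i is k.+1 then minn (row_count t a.+2 i) (row_count t a k) else row_count t a.+2 0.
Definition bk_row t i := (bk_lo t i + bk_hi t i - row_count t a.+1 i)%N.

Definition bk t : {ffun cell la -> 'I_N} :=
  [ffun x => let i := cell_row x in
             if (row_count t a i <= cell_col x < row_count t a.+2 i)%N
             then if (cell_col x < bk_row t i)%N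
                  then Ordinal (ltnW aN) else Ordinal aN
             else t x].

(** The reflected count still interlaces with the counts of its own row, of
    the row below and of the row above. *)
Lemma bk_bounds t i : ssyt t ->
  [/\ (row_count t a i <= bk_row t i <= row_count t a.+2 i)%N,
      (row_count t a.+2 i.+1 <= bk_row t i)%N,
      (bk_row t i.+1 <= row_count t a i)%N &
      (bk_row t i + row_count t a.+1 i = bk_lo t i + bk_hi t i)%N].
Proof.
move=> t_ssyt.
have q_bd k : (bk_lo t k <= row_count t a.+1 k <= bk_hi t k)%N.
  rewrite /bk_lo geq_max row_count_mono ?row_count_above //=.
  by case: k => [|k] /=; rewrite ?leq_min row_count_mono ?row_count_above.
have hi_s : (bk_hi t i <= row_count t a.+2 i)%N.
  by case: (i) => [|k] //=; apply: geq_minl.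
have := q_bd i; have := q_bd i.+1; rewrite /bk_row /bk_lo /=.
by split; lia.
Qed.

Lemma bkE t x : ssyt t ->
  bk t x = (if (a <= t x <= a.+1)%N
            then a + (bk_row t (cell_row x) <= cell_col x) else t x)%N :> nat.
Proof.
move=> t_ssyt; rewrite ffunE /= leqNgt -!row_countP // -leqNgt ltnS.
case: ifP => // _; rewrite [(bk_row _ _ <= _)%N]leqNgt.
by case: (cell_col x < _)%N; rewrite ?addn0 ?addn1.
Qed.

Lemma bk_lt t x b : ssyt t -> b != a.+1 -> (bk t x < b)%N = (t x < b)%N.
Proof.
move=> t_ssyt ba; rewrite bkE //; case: ifP => //.
by case: (bk_row _ _ <= _)%N => /=; lia.
Qed.

Lemma bk_lta t x : ssyt t ->
  (bk t x < a.+1)%N = (cell_col x < bk_row t (cell_row x))%N.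
Proof.
move=> t_ssyt; rewrite bkE //.
have [/andP[pq' q's] _ _ _] := bk_bounds (cell_row x) t_ssyt.
have := row_countP a x t_ssyt; have := row_countP a.+2 x t_ssyt.
by case: (leqP _ (cell_col x)) => /=; case: ifP; lia.
Qed.

(** Only the cells holding a or a + 1 change, so a column could fail only at
    an a directly above an a + 1; there the bounds on the reflected counts of
    the two rows apply. *)
Lemma bk_ssyt t : ssyt t -> ssyt (bk t).
Proof.
move=> t_ssyt; apply/ssytP => x y; rewrite !bkE //.
have [row_le col_lt] := ssytP _ t_ssyt x y; split => [xy|xy].
  have := row_le xy; case/andP: xy => /eqP <- ?.
  by case: (leqP _ (cell_col x)); case: (leqP _ (cell_col y)) => /=;
    case: ifP; case: ifP; lia.
have txy := col_lt xy; case: ifP => tx; case: ifP => ty //; last 2 first.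
- by case: (_ <= cell_col x)%N => /=; lia.
- by case: (_ <= cell_col y)%N => /=; lia.
have {tx ty} [tx ty] : nat_of_ord (t x) = a /\ nat_of_ord (t y) = a.+1 by lia.
case/andP: xy => /eqP cxy rxy.
have ryE : cell_row y = (cell_row x).+1.
  apply/eqP; rewrite eqn_leq rxy andbT leqNgt; apply/negP => rxy2.
  (* a cell strictly between x and y would have an entry strictly between *)
  have cy_lt := leq_trans (cell_col_lt y) (nth_part_le la (ltnW rxy2)).
  have [u [ru cu]] := ex_cell cy_lt.
  have [_ /(_ _)] := ssytP _ t_ssyt x u; have [_ /(_ _)] := ssytP _ t_ssyt u y.
  by rewrite /above ru cu cxy eqxx ltnSn rxy2 => /(_ isT) ? /(_ isT); lia.
have [_ s_q' _ _] := bk_bounds (cell_row x) t_ssyt.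
have [_ _ q'_p _] := bk_bounds (cell_row x) t_ssyt.
have := row_countP a x t_ssyt; have := row_countP a.+2 y t_ssyt.
rewrite ryE -cxy tx ty ltnn ltnSn.
by case: (leqP (bk_row t (cell_row x)) _); case: (leqP (bk_row t _.+1) _); lia.
Qed.

Lemma row_count_bk t b i : ssyt t ->
  row_count (bk t) b i = if b == a.+1 then bk_row t i else row_count t b i.
Proof.
move=> t_ssyt; have [/andP[_ q's] _ _ _] := bk_bounds i t_ssyt.
have bt_ssyt := bk_ssyt t_ssyt; have [->|ba] /= := eqVneq b a.+1.
  apply: row_count_uniq => // [|x <-]; last exact: bk_lta.
  exact: leq_trans q's (row_count_le _ _ _).
by apply: row_count_uniq => // [|x <-]; rewrite ?row_count_le // bk_lt // row_countP.
Qed.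

Lemma bkK t : ssyt t -> bk (bk t) = t.
Proof.
move=> t_ssyt; have bt_ssyt := bk_ssyt t_ssyt.
have q'' i : bk_row (bk t) i = row_count t a.+1 i.
  have [_ _ _ q'E] := bk_bounds i t_ssyt; have [_ _ _] := bk_bounds i bt_ssyt.
  have ->: bk_lo (bk t) i = bk_lo t i.
    by rewrite /bk_lo !row_count_bk //; do 2!case: eqP => //; lia.
  have ->: bk_hi (bk t) i = bk_hi t i.
    by case: i {q'E} => [|i] /=; rewrite !row_count_bk //; do 2?case: eqP => //; lia.
  by rewrite row_count_bk // eqxx; lia.
apply/ffunP => x; apply: val_inj => /=; rewrite bkE // q'' bkE //.
have := row_countP a.+1 x t_ssyt.
by case: (bk_row t _ <= _)%N; case: (leqP (row_count t _ _) _) => /=;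
  case: ifP; case: ifP; lia.
Qed.

(** The lower bound of row i and the upper bound of row i + 1 are the maximum
    and the minimum of the same two numbers, so the sum telescopes. *)
Lemma sum_bk_bounds t : ssyt t ->
  (\sum_(i < size la) (bk_lo t i + bk_hi t i) =
   \sum_(i < size la) (row_count t a i + row_count t a.+2 i))%N.
Proof.
move=> t_ssyt.
have partial k : (\sum_(i < k) (bk_lo t i + bk_hi t i) + bk_hi t k =
    \sum_(i < k) (row_count t a i + row_count t a.+2 i) + row_count t a.+2 k)%N.
  elim: k => [|k IHk]; first by rewrite !big_ord0.
  rewrite !big_ord_recr /= [bk_lo t k]/bk_lo; move: IHk.
  by move: (\sum_(i < k) _)%N (\sum_(i < k) _)%N => u v; lia.
have s_end : row_count t a.+2 (size la) = 0%N.
  by apply/eqP; rewrite -leqn0 -(nth_default 0%N (leqnn (size la))) row_count_le.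
have := partial (size la); rewrite s_end.
case: (size la) s_end => [|k] /=; first by rewrite !big_ord0.
by move=> ->; rewrite min0n !addn0.
Qed.

(** Reflection preserves the sum of q'_i + q_i, so the numbers of entries a
    and a + 1 are exchanged. *)
Lemma card_entries_bk t b : ssyt t ->
  #|[set x | bk t x == b :> nat]%SET| =
  #|[set x | t x == (if b == a then a.+1
                     else if b == a.+1 then a else b) :> nat]%SET|.
Proof.
move=> t_ssyt; have bt_ssyt := bk_ssyt t_ssyt; rewrite !card_entries //.
have sum_q' : (\sum_(i < size la) (bk_row t i + row_count t a.+1 i) =
    \sum_(i < size la) (row_count t a i + row_count t a.+2 i))%N.
  rewrite -sum_bk_bounds //; apply: eq_bigr => i _.
  by have [] := bk_bounds i t_ssyt.
have q_mono i : (row_count t a i <= row_count t a.+1 i <= row_count t a.+2 i)%N.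
  by rewrite !row_count_mono.
under eq_bigr do rewrite !row_count_bk //.
have [->|ba] := eqVneq b a.
  rewrite eqxx ltn_eqF //.
  (* adding the same sum on both sides turns the truncated differences into
     sums *)
  apply/eqP.
  rewrite -(eqn_add2r (\sum_(i < size la) (row_count t a i + row_count t a.+1 i))).
  rewrite -!big_split /=; apply/eqP; under eq_bigr => i _.
    have [/andP[pq' _] _ _ _] := bk_bounds i t_ssyt.
    rewrite addnA subnK //; over.
  rewrite sum_q'; apply: eq_bigr => i _; have := q_mono i; lia.
have [->|ba1] := eqVneq b a.+1.
  rewrite gtn_eqF //.
  apply/eqP.
  rewrite -(eqn_add2r (\sum_(i < size la) (row_count t a i + bk_row t i))).
  rewrite -!big_split /=; apply/eqP; under eq_bigr => i _.
    have [/andP[_ q's] _ _ _] := bk_bounds i t_ssyt.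
    rewrite addnCA subnK //; over.
  rewrite -sum_q'; apply: eq_bigr => i _; have := q_mono i; lia.
by apply: eq_bigr => i _; rewrite eqSS (negPf ba).
Qed.

End BenderKnuth.

(** * Symmetry of Schur polynomials *)

Section SchurSymmetry.
Variables (A : comNzRingType) (la : intpart) (N : nat).
Implicit Types (z : nat -> A).

(** The weight of a tableau depends only on its content. *)
Lemma prod_entries z (t : {ffun cell la -> 'I_N}) :
  \prod_x z (t x) = \prod_(b < N) z b ^+ #|[set x | t x == b :> nat]%SET|.
Proof.
rewrite (partition_big t xpredT) //=; apply: eq_bigr => b _.
rewrite (eq_bigr (fun=> z b)) => [|x /eqP -> //].
by rewrite prodr_const; congr (_ ^+ _); apply: eq_card => x; rewrite !inE.
Qed.

Lemma schur_swap z z' a : (a.+1 < N)%N ->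
    z' a = z a.+1 -> z' a.+1 = z a ->
    (forall b, b != a -> b != a.+1 -> z' b = z b) ->
  \sum_(t : {ffun cell la -> 'I_N} | ssyt t) \prod_x z (t x) =
  \sum_(t : {ffun cell la -> 'I_N} | ssyt t) \prod_x z' (t x).
Proof.
move=> aN za za1 zb; rewrite (reindex_onto (bk aN) (bk aN)) => [|t]; last exact: bkK.
apply: eq_big => [t|t /andP[bt_ssyt /eqP bbt]].
  apply/andP/idP => [[bt_ssyt /eqP <-]|t_ssyt]; first exact: bk_ssyt.
  by rewrite bk_ssyt // bkK.
have t_ssyt : ssyt t by rewrite -bbt; apply: bk_ssyt.
rewrite !prod_entries.
pose sw := tperm (Ordinal (ltnW aN)) (Ordinal aN).
rewrite (reindex_inj (@perm_inj _ sw)) /=; apply: eq_bigr => b _.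
rewrite card_entries_bk //.
case: tpermP => [->|->|ba ba1] /=.
- by rewrite za gtn_eqF // eqxx.
- by rewrite za1 eqxx.
have {}ba : b != a :> nat by apply/eqP => E; apply/ba/val_inj.
have {}ba1 : b != a.+1 :> nat by apply/eqP => E; apply/ba1/val_inj.
by rewrite zb // (negPf ba) (negPf ba1).
Qed.

(** A reversal is a composition of exchanges of neighbours. The prefix [p] is
    there for the induction. *)
Lemma schur_cat_rev (p s : seq A) : size (p ++ s) = N ->
  \sum_(t : {ffun cell la -> 'I_N} | ssyt t) \prod_x (p ++ s)`_(t x) =
  \sum_(t : {ffun cell la -> 'I_N} | ssyt t) \prod_x (p ++ rev s)`_(t x).
Proof.
(* moving one variable to the right past a block of others *)
have rot (u v w : seq A) y : size (u ++ y :: v ++ w) = N ->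
    \sum_(t : {ffun cell la -> 'I_N} | ssyt t) \prod_x (u ++ y :: v ++ w)`_(t x) =
    \sum_(t : {ffun cell la -> 'I_N} | ssyt t) \prod_x (u ++ v ++ y :: w)`_(t x).
  elim: v u => // v0 v IHv u szN.
  have /= := IHv (rcons u v0); rewrite !cat_rcons => <-; last first.
    by rewrite -szN !size_cat.
  apply: (@schur_swap _ _ (size u)).
  - by rewrite -szN !size_cat /=; lia.
  - by rewrite !nth_cat ltnn subnn ltnNge leqnSn /= subSnn.
  - by rewrite !nth_cat ltnn subnn ltnNge leqnSn /= subSnn.
  move=> b ba ba1; rewrite !nth_cat; case: ltnP => // ub.
  by case: (b - size u)%N (subnKC ub) => [|[|c]] //= E; move: ba ba1; rewrite -E; lia.
elim: s p => [|y s IHs] p szN; first by rewrite /rev.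
rewrite -cat_rcons IHs ?cat_rcons // rev_cons -cats1.
have := rot p (rev s) [::] y; rewrite cats0 => -> //.
by rewrite -szN !size_cat /= size_rev.
Qed.

Lemma schur_rssyt z :
  \sum_(t : {ffun cell la -> 'I_N} | ssyt t) \prod_x z (t x) =
  \sum_(t : {ffun cell la -> 'I_N} | rssyt t) \prod_x z (t x).
Proof.
pose rv (t : {ffun cell la -> 'I_N}) := [ffun x => rev_ord (t x)].
have rvK : involutive rv.
  by move=> t; apply/ffunP => x; rewrite !ffunE rev_ordK.
rewrite [RHS](reindex_inj (inv_inj rvK)) /=.
have zE (t : {ffun cell la -> 'I_N}) : \prod_x z (nat_of_ord (t x)) =
    \prod_(x : cell la) ([::] ++ mkseq z N)`_(t x).
  by apply: eq_bigr => x _; rewrite nth_mkseq.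
under eq_bigr do rewrite zE.
rewrite schur_cat_rev ?size_mkseq //; apply: eq_big => [t|t _].
  by rewrite /rssyt -/(rv _) rvK.
apply: eq_bigr => x _; rewrite ffunE /= nth_rev size_mkseq // nth_mkseq //.
by have := ltn_ord (t x); lia.
Qed.

End SchurSymmetry.

(** * Products of sums over functions *)

(** Distributivity when the index types of the sums vary: a choice of one
    function on each [J i] is a function on the disjoint union. *)
Lemma prod_sum_ffun_tagged (R : comNzRingType) (I : finType) (J : I -> finType)
    (B : finType) (P : forall i, pred {ffun J i -> B})
    (F : forall i, {ffun J i -> B} -> R) :
  \prod_i \sum_(t | P i t) F i t =
  \sum_(h : {ffun {i : I & J i} -> B} |
        [forall i, P i [ffun j => h (Tagged J j)]])
    \prod_i F i [ffun j => h (Tagged J j)].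
Proof.
pose G i := [ffun t => if P i t then F i t else 0].
transitivity (\prod_i \sum_t G i t).
  apply: eq_bigr => i _; rewrite big_mkcond; apply: eq_bigr => t _.
  by rewrite ffunE.
transitivity (\sum_(t : fprod (fun i => {ffun J i -> B})) \prod_i G i (t i)).
  rewrite (eq_bigr _ (fun i _ => big_tag G i)) bigA_distr_big_dep.
  rewrite [RHS]big_fprod; apply: eq_bigl => f.
  by apply/familyP/familyP.
pose glue (t : fprod (fun i => {ffun J i -> B})) : {ffun {i : I & J i} -> B} :=
  [ffun x => t (tag x) (tagged x)].
pose cut (h : {ffun {i : I & J i} -> B}) : fprod (fun i => {ffun J i -> B}) :=
  fprod_of_fun (fun i => [ffun j => h (Tagged J j)]).
have cutE h i : cut h i = [ffun j => h (Tagged J j)] by rewrite fprodE.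
rewrite (reindex cut) /=; last first.
  exists glue => [h _|t _].
    by apply/ffunP => -[i j]; rewrite ffunE /= cutE ffunE.
  by apply/fprodP => i; rewrite cutE; apply/ffunP => j; rewrite !ffunE.
rewrite [RHS]big_mkcond; apply: eq_bigr => h _ /=.
under eq_bigr do rewrite cutE.
case: ifP => [/forallP Ph|/negbT].
  by apply: eq_bigr => i _; rewrite ffunE Ph.
by rewrite negb_forall => /existsP[i /negPf Pi]; rewrite (bigD1 i) //= ffunE Pi mul0r.
Qed.

(** * Standardization *)

(** A bijection onto an initial segment that is increasing for a strict order
    must be the rank function of that order. *)
Lemma rank_unique (X : finType) n (lt : rel X) (T : X -> 'I_n) :
    bijective T -> (forall x y, (T x < T y)%N -> lt x y) ->
    irreflexive lt -> transitive lt ->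
  forall x, T x = #|[set y | lt y x]%SET| :> nat.
Proof.
move=> [U TU UT] T_lt lt_irr lt_tr x.
have ltE y : lt y x = (T y < T x)%N.
  apply/idP/idP => [yx|/T_lt//]; rewrite ltnNge leq_eqVlt; apply/negP.
  case/predU1P => [/val_inj/(can_inj TU) xy|/T_lt xy].
    by rewrite xy lt_irr in yx.
  by have := lt_tr _ _ _ yx xy; rewrite lt_irr.
have -> : [set y | lt y x]%SET = T @^-1: [set j : 'I_n | (j < T x)%N]%SET.
  by apply/setP => y; rewrite !inE ltE.
rewrite on_card_preimset; last by exists U => ? _.
rewrite -sum1_card (eq_bigl (fun j : 'I_n => j < T x)%N) => [|j]; last by rewrite inE.
by rewrite (big_ord_narrow (ltnW (ltn_ord (T x)))) sum1_card card_ord.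
Qed.

Section ReadingOrder.
Variables (r : nat) (la : 'I_r -> intpart).
Implicit Types (x y : mcell la).

Local Notation Cell k x := (Tagged (fun k => cell (la k)) (x : cell (la k))).

Definition mcol x : nat := cell_col (tagged x).

Lemma mrow_component x y : (component x < component y)%N -> (mrow x < mrow y)%N.
Proof.
case: x y => k x [l y]; rewrite /mrow /component /= => kl.
apply: leq_trans (leq_addr _ _).
rewrite [X in (_ < X)%N](bigID (fun i : 'I_r => i < k)%N) /=.
rewrite [X in (_ < X + _)%N](eq_bigl (fun i : 'I_r => (i < k)%N)) => [|i].
  rewrite ltn_add2l (bigD1 k) /=; last by rewrite kl ltnn.
  by apply: ltn_addr; apply: ltn_ord.
by lia.
Qed.

(** Avoids transporting cells along an equality of components. *)
Lemma eq_component x y : component x = component y ->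
  exists k (x' y' : cell (la k)), x = Cell k x' /\ y = Cell k y'.
Proof.
case: x y => k x [l y] /val_inj /= kl; subst l.
by exists k, x, y.
Qed.

Lemma mrow_eq x y : mrow x = mrow y ->
  exists k (x' y' : cell (la k)),
    [/\ x = Cell k x', y = Cell k y' & cell_row x' = cell_row y'].
Proof.
move=> rxy; have cxy : component x = component y.
  case: (ltngtP (component x) (component y)) => // /mrow_component;
    by rewrite rxy ltnn.
have [k [x' [y' [xE yE]]]] := eq_component cxy.
by exists k, x', y'; split=> //; move: rxy; rewrite xE yE => /addnI.
Qed.

(** The order in which standardization lists the cells. Ties are read from the
    bottom row upwards, so that a step between equal values never goes down
    and hence is not a descent. *)
Definition prec (h : mcell la -> nat) : rel (mcell la) := fun x y =>
  (h y < h x)%N || (h x == h y) &&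
    ((mrow y < mrow x)%N || (mrow x == mrow y) && (mcol x < mcol y)%N).

Lemma prec_irr h : irreflexive (prec h).
Proof. by move=> x; rewrite /prec !ltnn !andbF. Qed.

Lemma prec_trans h : transitive (prec h).
Proof. by move=> y x z; rewrite /prec; lia. Qed.

Lemma prec_total h x y : x != y -> prec h x y || prec h y x.
Proof.
move=> xy; have [[rxy cxy]|] := pselect (mrow x = mrow y /\ mcol x = mcol y).
  have [k [x' [y' [xE yE rx'y']]]] := mrow_eq rxy.
  by move: cxy xy; rewrite xE yE => /(cell_inj rx'y') ->; rewrite eqxx.
by rewrite /prec; lia.
Qed.

End ReadingOrder.

Section Standardization.
Variables (r n : nat) (la : 'I_r -> intpart).
Hypothesis la_n : (\sum_(k < r) sumn (la k))%N = n.
Implicit Types (x y : mcell la) (T : {ffun mcell la -> 'I_n}).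

Local Notation Cell k x := (Tagged (fun k => cell (la k)) (x : cell (la k))).

Lemma card_mcell : #|{: mcell la}| = n.
Proof.
transitivity (\sum_(k < r) \sum_(x : cell (la k)) 1)%N.
  by rewrite sig_big_dep sum1_card.
rewrite -la_n; apply: eq_bigr => k _; rewrite (sum_cells _ (fun _ _ => 1%N)).
rewrite sumnE (big_nth 0%N) big_mkord; apply: eq_bigr => i _.
by rewrite sum1_card card_ord.
Qed.

Lemma rank_subproof h x : (#|[set y | prec h y x]%SET| < n)%N.
Proof.
rewrite -[X in (_ < X)%N]card_mcell -cardsT; apply: proper_card.
by apply/properP; split=> //; exists x; rewrite ?inE ?prec_irr.
Qed.

(** The standardization of h: the rank of every cell in the order [prec h]. *)
Definition std h : {ffun mcell la -> 'I_n} := [ffun x => Ordinal (rank_subproof h x)].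

Lemma std_lt h x y : (std h x < std h y)%N = prec h x y.
Proof.
have mono u v : prec h u v -> (std h u < std h v)%N.
  move=> uv; rewrite !ffunE /=; apply: proper_card; apply/properP; split.
    by apply/fintype.subsetP => w; rewrite !inE => /prec_trans; apply.
  by exists u; rewrite !inE ?prec_irr.
apply/idP/idP => [xy|/mono//].
have /(prec_total h)/orP[//|/mono yx] : x != y.
  by apply: contraTneq xy => ->; rewrite ltnn.
by move: xy yx; lia.
Qed.

Lemma std_inj h : injective (std h).
Proof.
move=> x y xy; apply/eqP/negPn/negP => /(prec_total h).
by rewrite -!std_lt xy ltnn.
Qed.

Lemma syt_bij T : injective T -> bijective T.
Proof. by move=> T_inj; apply: inj_card_bij; rewrite ?card_mcell ?card_ord. Qed.

Lemma sytP T :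
  reflect (injective T /\ forall k (x y : cell (la k)),
             left_of x y || above x y -> (T (Cell k x) < T (Cell k y))%N)
          (is_syt T).
Proof.
apply: (iffP andP) => -[T1 T2]; split.
- move=> x y xy; have /cards1P[u Tu] := forallP T1 (T x).
  have: x \in [set u]%SET by rewrite -Tu inE.
  have: y \in [set u]%SET by rewrite -Tu inE xy.
  by rewrite !inE => /eqP -> /eqP.
- move=> k x y xy; have /forallP/(_ x)/forallP/(_ y) := forallP T2 k.
  by rewrite xy.
- apply/forallP => i; have [U TU UT] := syt_bij T1.
  apply/cards1P; exists (U i); apply/setP => x; rewrite !inE.
  by apply/eqP/eqP => [<-|->]; rewrite ?TU ?UT.
apply/forallP => k; apply/forallP => x; apply/forallP => y.
by apply/implyP/T2.
Qed.

Variable N : nat.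
Implicit Types (h : {ffun mcell la -> 'I_N}).

Definition mrssyt h := [forall k, rssyt [ffun x => h (Cell k x)]].

Lemma mrssytP h :
  reflect (forall k (x y : cell (la k)),
             (left_of x y -> (h (Cell k y) <= h (Cell k x))%N) /\
             (above x y -> (h (Cell k y) < h (Cell k x))%N))
          (mrssyt h).
Proof.
apply: (iffP forallP) => hr k => [x y|].
  by have /rssytP/(_ x y) := hr k; rewrite !ffunE.
by apply/rssytP => x y; rewrite !ffunE.
Qed.

(** The filling h weakly decreases along T, and strictly at the descents of T:
    for cells x and y that are consecutive in T, the entry of x is a descent
    exactly when y lies in a lower row. *)
Definition descent_compat T h :=
  [forall x, forall y, (T y == (T x).+1 :> nat) ==>
                       (h y + (mrow x < mrow y) <= h x)%N].

Lemma descent_compatP T h :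
  reflect (forall x y, T y = (T x).+1 :> nat -> (h y + (mrow x < mrow y) <= h x)%N)
          (descent_compat T h).
Proof.
apply: (iffP forallP) => hT x => [y /eqP xy|].
  by have /forallP/(_ y)/implyP/(_ xy) := hT x.
by apply/forallP => y; apply/implyP => /eqP; apply: hT.
Qed.

Local Notation nat_of h := (fun x => nat_of_ord (h x)).

Lemma std_syt h : mrssyt h -> is_syt (std (nat_of h)).
Proof.
move=> /mrssytP hr; apply/sytP; split=> [|k x y xy]; first exact: std_inj.
rewrite std_lt /prec /mrow /mcol /=; have [hl ha] := hr k x y.
case/orP: xy => xy; last by rewrite ha.
by have := hl xy; case/andP: xy => /eqP -> ->; lia.
Qed.

Lemma std_descent_compat h : descent_compat (std (nat_of h)) h.
Proof.
apply/descent_compatP => x y xy; have : prec (nat_of h) x y by rewrite -std_lt xy.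
by rewrite /prec; case: ltngtP => //=; lia.
Qed.

(** It suffices to compare consecutive cells of T. If the values are equal there
    is no descent, so the second cell is not lower; if it lies in the same row,
    it lies to the right because T increases along rows. *)
Lemma compat_prec T h x y : is_syt T -> descent_compat T h ->
  (T x < T y)%N -> prec (nat_of h) x y.
Proof.
move=> /sytP[T_inj T_mono] /descent_compatP hT.
have [U TU UT] := syt_bij T_inj.
have step u v : T v = (T u).+1 :> nat -> prec (nat_of h) u v.
  move=> uv; have := hT _ _ uv; rewrite /prec.
  case: (ltngtP (mrow u) (mrow v)) => ruv /=; try lia.
  have [k [u' [v' [uE vE ru'v']]]] := mrow_eq ruv.
  suff cuv : (mcol u < mcol v)%N by lia.
  rewrite ltnNge leq_eqVlt; apply/negP => /predU1P[cuv|cuv].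
    have u'v' : v' = u' by apply: cell_inj; move: cuv; rewrite ?uE ?vE.
    by move: uv; rewrite uE vE u'v'; lia.
  have := T_mono k v' u'; rewrite /left_of ru'v' eqxx.
  by move: cuv; rewrite uE vE /mcol /= => -> /(_ isT); move: uv; rewrite uE vE; lia.
have ex_cell m : (m < n)%N -> exists u, T u = m :> nat.
  by move=> mn; exists (U (Ordinal mn)); rewrite UT.
have [m] := ubnP (T y - T x)%N; elim: m x => // m IHm x xy_m xy.
have [z Tz] := ex_cell _ (leq_ltn_trans xy (ltn_ord (T y))).
have xz := step _ _ Tz.
have [zy|zy] := ltnP (T z) (T y); first by apply: prec_trans xz (IHm _ _ zy); lia.
by have <- : z = y; [apply/T_inj/val_inj => /=; lia|].
Qed.

Lemma compat_std T h : is_syt T -> descent_compat T h -> std (nat_of h) = T.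
Proof.
move=> T_syt hT; have /sytP[T_inj _] := T_syt.
apply/ffunP => x; apply: val_inj; rewrite ffunE /=.
symmetry; apply: rank_unique x; first exact: syt_bij.
- by move=> x y; apply: compat_prec.
- exact: prec_irr.
exact: prec_trans.
Qed.

Lemma compat_mrssyt T h : is_syt T -> descent_compat T h -> mrssyt h.
Proof.
move=> T_syt hT; have /sytP[T_inj T_mono] := T_syt.
apply/mrssytP => k x y; split=> xy.
  have /(compat_prec T_syt hT) : (T (Cell k x) < T (Cell k y))%N.
    by apply: T_mono; rewrite xy.
  by rewrite /prec; lia.
have /(compat_prec T_syt hT) : (T (Cell k x) < T (Cell k y))%N.
  by apply: T_mono; rewrite xy orbT.
by rewrite /prec /mrow /=; case/andP: xy; lia.
Qed.

(** Fundamental lemma of P-partitions: the fillings with standardization T are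
    those compatible with the descents of T. *)
Lemma sum_mrssyt (A : nmodType) (F : {ffun mcell la -> 'I_N} -> A) :
  \sum_(h | mrssyt h) F h =
  \sum_(T : {ffun mcell la -> 'I_n} | is_syt T) \sum_(h | descent_compat T h) F h.
Proof.
rewrite (partition_big (fun h => std (nat_of h)) (@is_syt r la n)) => [|h]; last first.
  exact: std_syt.
apply: eq_bigr => T T_syt; apply: eq_bigl => h.
apply/andP/idP => [[_ /eqP <-]|hT]; first exact: std_descent_compat.
by split; [apply: compat_mrssyt hT|apply/eqP/compat_std].
Qed.

End Standardization.

(** * The fillings with a given standardization *)

Section FixedTableau.
Variables (K : comNzRingType) (r n : nat) (la : 'I_r -> intpart).
Variables (T : {ffun mcell la -> 'I_n}) (U : 'I_n -> mcell la).
Hypotheses (TU : cancel T U) (UT : cancel U T).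

Lemma syt_cE i : syt_c T i = component (U i).
Proof.
rewrite /syt_c; case: pickP => [x /eqP <-|/(_ (U i))]; first by rewrite TU.
by rewrite UT eqxx.
Qed.

Lemma is_descentE x y : T y = (T x).+1 :> nat ->
  is_descent T (T x) = (mrow x < mrow y)%N.
Proof.
move=> xy; apply/existsP/idP => [[x' /existsP[y' /and3P[/eqP x'x]]]|rxy].
  rewrite -xy => /eqP/val_inj y'y.
  by rewrite -[x]TU -x'x TU -[y]TU -y'y TU.
by exists x; apply/existsP; exists y; rewrite eqxx xy eqxx.
Qed.

Lemma is_descent_last (i : 'I_n) : i.+1 = n -> is_descent T i = false.
Proof.
move=> iN; apply/existsP => -[x /existsP[y /and3P[_ /eqP]]].
by rewrite iN => yn; have := ltn_ord (T y); rewrite yn ltnn.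
Qed.

(** The value at position i of the filling whose drops along T exceed the drops
    forced by the descents by the amounts [k]. *)
Definition suffix_sum (k : 'I_n -> nat) (i : nat) :=
  (\sum_(j < n | (i <= j)%N) (k j + is_descent T j))%N.

Lemma suffix_sum_recl k (i : 'I_n) :
  suffix_sum k i = (k i + is_descent T i + suffix_sum k i.+1)%N.
Proof.
rewrite /suffix_sum (bigD1 i) //=; congr (_ + _)%N; apply: eq_bigl => j.
by rewrite ltn_neqAle eq_sym andbC.
Qed.

Lemma suffix_sum_end k : suffix_sum k n = 0%N.
Proof. by rewrite /suffix_sum big_pred0 // => j; rewrite leqNgt ltn_ord. Qed.

(** Summing the descents j >= i gives d_i(T), and the remaining part of the
    exponent is that of the geometric series. *)
Lemma syt_fE k (i : 'I_n) :
  (syt_f T i + r * \sum_(j < n | (i <= j)%N) k j =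
   component (U i) + suffix_sum k i * r)%N.
Proof.
have dE : syt_d T i = (\sum_(j < n | (i <= j)%N) is_descent T j)%N.
  rewrite /syt_d -sum1_card.
  rewrite (eq_bigl (fun j : 'I_n => (i <= j) && is_descent T j)%N) => [|j].
    by rewrite big_mkcondr; apply: eq_bigr => j _; case: is_descent.
  by rewrite inE andbC.
by rewrite /syt_f syt_cE dE /suffix_sum big_split /=; lia.
Qed.

Section Bound.
Variable N : nat.
Local Notation M := N.+1.

(** The filling with excess drops [k]. Values that do not fit below the bound
    are replaced arbitrarily by [inord]; they only occur in degrees beyond the
    truncation. *)
Definition fill (k : {ffun 'I_n -> 'I_M}) : {ffun mcell la -> 'I_M} :=
  [ffun x => inord (suffix_sum (fun j => k j) (T x))].

(** The values along T, extended by 0 past the last cell so that the last value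
    is a drop like the others. *)
Definition val_at (h : {ffun mcell la -> 'I_M}) (i : nat) : nat :=
  if insub i is Some j then h (U j) else 0%N.

(** The excess drops of a filling; inverse to [fill]. *)
Definition steps (h : {ffun mcell la -> 'I_M}) : {ffun 'I_n -> 'I_M} :=
  [ffun j : 'I_n => inord (val_at h j - val_at h j.+1 - is_descent T j)].

Lemma val_atE h x : val_at h (T x) = h x.
Proof.
rewrite /val_at; case: insubP => [j _ /val_inj ->|]; first by rewrite TU.
by rewrite ltn_ord.
Qed.

Lemma val_at_end h : val_at h n = 0%N.
Proof. by rewrite /val_at insubF ?ltnn. Qed.

Lemma val_at_step h (i : 'I_n) : descent_compat T h ->
  (val_at h i.+1 + is_descent T i <= val_at h i)%N.
Proof.
move=> /descent_compatP hT; have [iN|] := ltnP i.+1 n.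
  have UE : T (U (Ordinal iN)) = (T (U i)).+1 :> nat by rewrite !UT.
  have := hT _ _ UE; rewrite -(is_descentE UE) !UT -!val_atE !UT //.
move=> ni; have iN : i.+1 = n by apply/eqP; rewrite eqn_leq ltn_ord.
by rewrite is_descent_last // iN val_at_end.
Qed.

(** The differences telescope, starting from the end. *)
Lemma suffix_sum_steps h i : descent_compat T h -> (i <= n)%N ->
  suffix_sum (fun j => steps h j) i = val_at h i.
Proof.
move=> hT i_le; rewrite -(subKn i_le); move: (n - i)%N (leq_subr i n) => d.
elim: d => [|d IHd] dn; first by rewrite subn0 suffix_sum_end val_at_end.
have iN : (n - d.+1 < n)%N by lia.
have idE : (n - d = (n - d.+1).+1)%N by lia.
have := suffix_sum_recl (fun j => steps h j) (Ordinal iN).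
have := val_at_step (Ordinal iN) hT; rewrite /= -idE => st ->.
rewrite IHd ?(ltnW dn) // ffunE inordK /= -idE.
  by lia.
rewrite ltnS -subnDA.
apply: leq_trans (leq_subr _ _) _; rewrite /val_at.
by case: insubP => // j _ _; rewrite -ltnS.
Qed.

Lemma stepsK h : descent_compat T h -> fill (steps h) = h.
Proof.
move=> hT; apply/ffunP => x; apply: val_inj.
by rewrite ffunE /= suffix_sum_steps ?(ltnW (ltn_ord _)) // val_atE inord_val.
Qed.

Section Small.
Variable k : {ffun 'I_n -> 'I_M}.
Hypothesis k_small : forall i : 'I_n, (suffix_sum (fun j => k j) i < M)%N.

Lemma fillE x : fill k x = suffix_sum (fun j => k j) (T x) :> nat.
Proof. by rewrite ffunE inordK. Qed.

Lemma val_at_fill (i : nat) : (i <= n)%N ->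
  val_at (fill k) i = suffix_sum (fun j => k j) i.
Proof.
rewrite leq_eqVlt => /predU1P[->|iN]; first by rewrite val_at_end suffix_sum_end.
by have := val_atE (fill k) (U (Ordinal iN)); rewrite fillE UT.
Qed.

Lemma fillK : steps (fill k) = k.
Proof.
apply/ffunP => i; rewrite ffunE !val_at_fill ?(ltnW (ltn_ord i)) //.
apply: val_inj => /=; rewrite suffix_sum_recl addnK addnK.
by rewrite inordK.
Qed.

Lemma fill_descent_compat : descent_compat T (fill k).
Proof.
apply/descent_compatP => x y xy.
rewrite !fillE (suffix_sum_recl _ (T x)) xy (is_descentE xy).
by rewrite addnAC -addnA leq_addl.
Qed.

End Small.

Definition fill_weight (H : 'I_n -> nat) : {cmonom nat} :=
  part_monomial [seq (component (U i) + H i * r)%N | i <- enum 'I_n].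

Lemma fill_weightE H (i : 'I_n) : fill_weight H i = (component (U i) + H i * r)%N.
Proof.
by rewrite part_monomialE (nth_map i) ?size_enum_ord // nth_ord_enum.
Qed.

Lemma eq_fill_weight H H' : H =1 H' -> fill_weight H = fill_weight H'.
Proof. by move=> HH'; congr part_monomial; apply: eq_map => i; rewrite HH'. Qed.

(** [fill] and [steps] match the terms of the two sums that contribute to a
    monomial m of degree at most N: the weight of [k] being m bounds all the
    values of [fill k] by the exponents of m, so none is altered by [inord]. *)
Lemma eqtrunc_descent_compat : (0 < r)%N ->
  eqtrunc M
    (\sum_(h : {ffun mcell la -> 'I_M} | descent_compat T h)
       fps_monomial K (fill_weight (fun i => h (U i))))
    (\sum_(k : {ffun 'I_n -> 'I_M})
       fps_monomial K (fill_weight (fun i => suffix_sum (fun j => k j) i))).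
Proof.
move=> r_gt0 m mM; rewrite !fcoef_sum /=.
under eq_bigr do rewrite mulrb; rewrite -big_mkcondr /=.
under [RHS]eq_bigr do rewrite mulrb; rewrite -big_mkcond /=.
rewrite (reindex_onto fill steps) => [|h /andP[hT _]]; last exact: stepsK.
apply: eq_bigl => k; apply/andP/eqP => [[/andP[kT /eqP ->] /eqP kK]|mE].
  apply: eq_fill_weight => i; rewrite -val_atE UT -suffix_sum_steps // ?kK //.
  exact: ltnW (ltn_ord _).
have k_small (i : 'I_n) : (suffix_sum (fun j => k j) i < M)%N.
  apply: leq_ltn_trans mM; apply: leq_trans (cm_le_mdeg m i).
  by rewrite mE fill_weightE; apply: leq_trans (leq_pmulr _ r_gt0) (leq_addl _ _).
rewrite fill_descent_compat // fillK // eqxx; split=> //=; apply/eqP.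
by rewrite mE; apply: eq_fill_weight => i; rewrite fillE // UT.
Qed.

End Bound.

(** The numbers component + r * h decrease along T: if the component increases
    from one cell to the next, the second cell is lower, so h drops by at least
    1, which outweighs the increase of the component, less than r. *)
Lemma conj_map_descent_compat N (h : {ffun mcell la -> 'I_N}) :
    descent_compat T h ->
  conj_map (\prod_x zseq K r (component x) (h x)) =
  fps_monomial K (fill_weight (fun i => h (U i))).
Proof.
move=> /descent_compatP hT; rewrite (reindex U) /=; last by exists T => x _.
pose v i := (component (U i) + h (U i) * r)%N.
transitivity (conj_map (\prod_(c <- [seq v i | i <- enum 'I_n])
    fps_monomial K (part_monomial (nseq c 1%N)))).
  rewrite big_map big_enum; congr conj_map.
  by apply: eq_bigr => i _; rewrite zseqE.
rewrite conj_map_prod_sorted //; apply/(sortedP 0%N) => i.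
rewrite size_map size_enum_ord => iN; pose j := Ordinal (ltnW iN).
rewrite !(nth_map j) -?enumT ?size_enum_ord ?(ltnW iN) //.
rewrite /v; have -> : nth j (enum 'I_n) i = j := nth_ord_enum j j.
have -> : nth j (enum 'I_n) i.+1 = Ordinal iN := nth_ord_enum j (Ordinal iN).
have := hT (U j) (U (Ordinal iN)); rewrite !UT => /(_ erefl).
have := @mrow_component r la (U j) (U (Ordinal iN)).
have := ltn_ord (tag (U (Ordinal iN))); rewrite -/(component _).
case: (ltnP (component (U j)) (component (U (Ordinal iN)))).
  by move=> _ cr /(_ isT) -> hUj; nia.
by move=> cc _ _ hUj; nia.
Qed.

End FixedTableau.

(** * The generating function *)

(** The variable of index j occurs in the i-th factor exactly when j <= i. *)
Lemma prod_prefix (A : comNzRingType) (v : nat -> A) n r (k : 'I_n -> nat) :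
  \prod_(i < n) (\prod_(j < i.+1) v j ^+ r) ^+ k i =
  \prod_(j < n) v j ^+ (r * \sum_(i < n | (j <= i)%N) k i).
Proof.
transitivity (\prod_(i < n) \prod_(j < n | (j <= i)%N) v j ^+ (r * k i)).
  apply: eq_bigr => i _; rewrite -prodrXl.
  rewrite (big_ord_widen_cond n xpredT (fun j => (v j ^+ r) ^+ k i)) //.
  by apply: eq_bigr => j _; rewrite exprM.
rewrite (exchange_big_dep xpredT) //=; apply: eq_bigr => j _.
by rewrite prodrXr big_distrr.
Qed.

Lemma conj_map_prod_schur (K : comNzRingType) (r n : nat)
    (la : 'I_r -> intpart) :
    (0 < r)%N -> (\sum_(k < r) sumn (la k))%N = n ->
  conj_map (\prod_(k < r) schur (la k) (zseq K r k)) =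
  (\sum_(T : {ffun mcell la -> 'I_n} | is_syt T)
      \prod_(i < n) fps_var K i ^+ syt_f T i)
  / \prod_(i < n) (1 - \prod_(j < i.+1) fps_var K j ^+ r).
Proof.
move=> r_gt0 la_n; apply: eqtrunc_eq => N.
apply: (@eqtruncW _ N.+1) => //.
pose e (i : 'I_n) : {cmonom nat} :=
  part_monomial [seq r | j <- enum 'I_i.+1].
have eE (i : 'I_n) : \prod_(j < i.+1) fps_var K j ^+ r = fps_monomial K (e i).
  by rewrite prod_fps_var.
have e_gt0 (i : 'I_n) : (0 < mdeg (e i))%N.
  by rewrite mdeg_part_monomial /= enum_ordSl /= addn_gt0 r_gt0.
have z_ord k c : eqtrunc c (zseq K r k c) 0.
  rewrite zseqE; apply: eqtrunc_monomial0; rewrite mdeg_part_monomial sumn_nseq.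
  nia.
apply: (@eqtrunc_trans _ _ (conj_map (\sum_(h : {ffun mcell la -> 'I_N.+1} | mrssyt h)
    \prod_x zseq K r (component x) (h x)))).
  apply: eqtrunc_conj_map.
  apply: (@eqtrunc_trans _ _ (\prod_(k < r)
      \sum_(t : {ffun cell (la k) -> 'I_N.+1} | rssyt t) \prod_x zseq K r k (t x))).
    apply: eqtrunc_prod => k _; rewrite -schur_rssyt.
    exact/eqtrunc_schur/z_ord.
  rewrite prod_sum_ffun_tagged; apply: eqtrunc_sum => h _.
  rewrite sig_big_dep; apply: eqtrunc_prod => -[k x] _.
  by rewrite ffunE.
rewrite conj_map_sum (sum_mrssyt la_n).
rewrite -prodrV => [|i _]; last by rewrite eE one_sub_monomial_unit.
rewrite mulr_suml; apply: eqtrunc_sum => T T_syt.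
have /(sytP la_n)[T_inj _] := T_syt; have [U TU UT] := syt_bij la_n T_inj.
rewrite (eq_bigr _ (fun h => @conj_map_descent_compat K _ _ _ _ _ TU UT _ h)).
apply: eqtrunc_trans; first exact: (eqtrunc_descent_compat K TU UT r_gt0).
apply: (@eqtrunc_trans _ _ ((\prod_(i < n) fps_var K i ^+ syt_f T i) *
    \prod_(i < n) \sum_(k < N.+1) fps_monomial K (expcmn (e i) k))); last first.
  apply: eqtrunc_mul => //; apply: eqtrunc_prod => i _.
  by rewrite eE; apply/eqtrunc_sym/eqtrunc_geometric.
rewrite bigA_distr_bigA mulr_sumr; apply: eqtrunc_sum => k _.
suff -> : fps_monomial K (fill_weight U (fun i => suffix_sum T (fun j => k j) i)) =
    \prod_(i < n) fps_var K i ^+ syt_f T i *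
    \prod_(i < n) fps_monomial K (expcmn (e i) (k i)) by exact: eqtrunc_refl.
rewrite /fill_weight -prod_fps_var.
under [X in _ * X]eq_bigr do rewrite fps_monomialX -eE.
rewrite [X in _ * X](prod_prefix (fps_var K) r (fun i => k i)) -big_split.
apply: eq_bigr => i _ /=.
by rewrite -exprD (syt_fE TU UT).
Qed.

Theorem proposition9p3 (R : realType) (r n : nat) (r_gt0 : (0 < r)%N)
    (n_gt0 : (0 < n)%N) (la : 'I_r -> intpart)
    (la_n : (\sum_(k < r) sumn (la k))%N = n) :
  conj_map (\prod_(k < r) schur (la k) (zseq R[i] r k)) =
  (\sum_(T : {ffun mcell la -> 'I_n} | is_syt T)
      \prod_(i < n) fps_var R[i] i ^+ syt_f T i)
  / \prod_(i < n) (1 - \prod_(j < i.+1) fps_var R[i] j ^+ r).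
Proof. exact: conj_map_prod_schur. Qed.
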